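(* Let $G$ be a connected graph on $n\ge 3$ vertices, and let $\lambda_1\ge\lambda_2\ge\cdots\ge\lambda_n$ be the eigenvalues of its normalized adjacency matrix $D^{-1}A$. Then $$-\frac{1}{n-1}-\frac{1}{n-1}\sqrt{(n-2)[2(n-1)R_{-1}(G)-n]}\le\lambda_n\le-\frac{1}{n-1}-\frac{1}{n-1}\sqrt{\frac{2(n-1)R_{-1}(G)-n}{n-2}}$$ and $$-\frac{1}{n-1}+\frac{1}{n-1}\sqrt{\frac{2(n-1)R_{-1}(G)-n}{n-2}}\le\lambda_2\le-\frac{1}{n-1}+\frac{1}{n-1}\sqrt{(n-2)[2(n-1)R_{-1}(G)-n]}.$$
   Context: Graphs are simple, finite and undirected. $A$ is the adjacency matrix ($(i,j)$ entry $1$ if $i,j$ adjacent, $0$ otherwise), $D$ is the diagonal matrix of vertex degrees $d_i$, and $D^{-1}A$ is the normalized adjacency matrix (its eigenvalues are real). $R_{-1}(G)=\sum_{\{i,j\}\in E}\frac{1}{d_id_j}$ is the general Randić index with exponent $-1$, the sum being over the edges of $G$. *)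

(* Defs.v *)
From HB Require Import structures.
From mathcomp Require Import all_boot all_order all_algebra.
Set Implicit Arguments.
Unset Strict Implicit.
Unset Printing Implicit Defensive.
Import Order.TTheory GRing.Theory Num.Theory.
Local Open Scope ring_scope.

(* A graph on n vertices is a relation on 'I_n; simple undirected graphs are
   the symmetric and irreflexive ones. *)

Definition connected_graph (n : nat) (e : rel 'I_n) : Prop :=
  forall i j : 'I_n, connect e i j.

Definition degree (n : nat) (e : rel 'I_n) (i : 'I_n) : nat :=
  #|[set j | e i j]|.

Definition adjacency_mx (R : rcfType) (n : nat) (e : rel 'I_n) : 'M[R]_n :=
  \matrix_(i, j) (e i j)%:R.

Definition degree_mx (R : rcfType) (n : nat) (e : rel 'I_n) : 'M[R]_n :=
  diag_mx (\row_i (degree e i)%:R).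

(* invmx is the matrix inverse only when all degrees are nonzero, as is the
   case for connected graphs on at least two vertices. *)
Definition normalized_adjacency_mx (R : rcfType) (n : nat) (e : rel 'I_n) :
    'M[R]_n :=
  invmx (degree_mx R e) *m adjacency_mx R e.

(* The condition i < j makes each edge {i, j} count exactly once. *)
Definition randic_index_m1 (R : rcfType) (n : nat) (e : rel 'I_n) : R :=
  \sum_(i < n) \sum_(j < n | (i < j)%N && e i j)
    ((degree e i)%:R * (degree e j)%:R)^-1.

(* l lists the eigenvalues of M with their algebraic multiplicities, in
   nonincreasing order; the k-th largest eigenvalue is l`_(k - 1). *)
Definition ordered_eigenvalues (R : rcfType) (n : nat) (M : 'M[R]_n)
    (l : n.-tuple R) : Prop :=
  sorted >=%R l /\ char_poly M = \prod_(x <- l) ('X - x%:P).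

(* Main.v *)
(* The matrix M = D^-1 A is row-stochastic, so its largest eigenvalue is 1. As
   tr M = 0 and tr (M^2) = 2 R_(-1), the other n - 1 eigenvalues have sum -1 and
   sum of squares 2 R_(-1) - 1, hence a known mean and variance, and the
   Wolkowicz-Styan inequalities bound their minimum and maximum. The sum of the
   squared eigenvalues is tr (M^2) because
   det (X^2 - M^2) = det (X - M) det (X + M). *)
Require Import Defs.
From HB Require Import structures.
From mathcomp Require Import all_boot all_order all_algebra ring lra.
Set Implicit Arguments.
Unset Strict Implicit.
Unset Printing Implicit Defensive.
Import Order.TTheory GRing.Theory Num.Theory.
Local Open Scope ring_scope.

(** * Power sums of the eigenvalues as traces *)

Lemma char_poly_comp (R : comNzRingType) (n : nat) (A : 'M[R]_n)
    (q : {poly R}) :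
  char_poly A \Po q = \det (q%:M - map_mx polyC A).
Proof.
rewrite -[LHS](det_map_mx (comp_poly q)); congr (\det _).
by apply/matrixP=> i j; rewrite !mxE rmorphB rmorphMn /= comp_polyX comp_polyC.
Qed.

Lemma size_eigenvalues (R : comNzRingType) (n : nat) (A : 'M[R]_n) (s : seq R) :
  char_poly A = \prod_(x <- s) ('X - x%:P) -> size s = n.
Proof.
move=> charA; apply/succn_inj.
by rewrite -(size_prod_XsubC s id) -charA size_char_poly.
Qed.

(** Up to sign, both sides are the coefficient of X^(n-1) in the characteristic polynomial. For n =
    0 there is no such coefficient, and both sums are empty. *)
Lemma sum_eigenvalues (R : comNzRingType) (n : nat) (A : 'M[R]_n) (s : seq R) :
  char_poly A = \prod_(x <- s) ('X - x%:P) -> \sum_(x <- s) x = \tr A.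
Proof.
move=> charA; have size_s := size_eigenvalues charA.
have [n0|n_gt0] := posnP n.
  rewrite {}n0 in A charA size_s *; rewrite (size0nil size_s) big_nil.
  by rewrite /mxtrace big_ord0.
apply: oppr_inj; rewrite -char_poly_trace // charA -{1}size_s.
by rewrite coefPn_prod_XsubC // size_s -lt0n.
Qed.

(** Composing with -X gives det (-X - A); the sign (-1)^n turns this into det (X + A). *)
Lemma char_poly_sqr_comp (R : comNzRingType) (n : nat) (A : 'M[R]_n) :
  char_poly (A *m A) \Po 'X^2 =
  char_poly A * ((-1) ^+ n * (char_poly A \Po - 'X)).
Proof.
rewrite -[in X in X * _](comp_polyXr (char_poly A)) !char_poly_comp.
rewrite -detZ -det_mulmx; congr (\det _).
rewrite scaleN1r opprB raddfN opprK map_mxM mulmxBl !mulmxDr /=.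
rewrite -scalar_mxM -scalar_mxC -expr2 [X in _ = X - _]addrC [X in _ = _ - X]addrC.
by rewrite opprD addrA addrK.
Qed.

Lemma char_poly_sqr (R : idomainType) (n : nat) (A : 'M[R]_n) (s : seq R) :
  char_poly A = \prod_(x <- s) ('X - x%:P) ->
  char_poly (A *m A) = \prod_(x <- s) ('X - (x ^+ 2)%:P).
Proof.
move=> charA; have size_s := size_eigenvalues charA.
(* Over an integral domain, substitution of X^2 is injective, so it suffices to compare after it.
   There each factor X^2 - x^2 splits as (X - x)(X + x). *)
apply/eqP; rewrite -subr_eq0 -(@comp_poly_eq0 _ _ 'X^2) ?size_polyXn //.
rewrite comp_polyB char_poly_sqr_comp charA !rmorph_prod /= subr_eq0 -size_s.
apply/eqP; elim: s {charA size_s} => [|x s IHs]; first by rewrite !big_nil !mul1r.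
rewrite !big_cons -{}IHs /= !comp_polyB !comp_polyX !comp_polyC exprS polyCM.
by set P := \prod_(j <- s) _; set Q := \prod_(j <- s) _; ring.
Qed.

Lemma sum_sqr_eigenvalues (R : idomainType) (n : nat) (A : 'M[R]_n) (s : seq R) :
  char_poly A = \prod_(x <- s) ('X - x%:P) ->
  \sum_(x <- s) x ^+ 2 = \tr (A *m A).
Proof.
move=> /char_poly_sqr charA2.
by rewrite -(@sum_eigenvalues _ _ _ [seq x ^+ 2 | x <- s]) ?big_map.
Qed.

(** * Distance of an extreme value from the mean *)

Section Deviation.
Variable R : realFieldType.
Implicit Types (x : R) (s : seq R).

Lemma sqr_sum_le s :
  (\sum_(y <- s) y) ^+ 2 <= (size s)%:R * \sum_(y <- s) y ^+ 2.
Proof.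
elim: s => [|a s IHs]; first by rewrite !big_nil expr0n mul0r.
rewrite !big_cons /= -natr1.
have [k_eq0|k_gt0] := posnP (size s).
  by rewrite (size0nil k_eq0) /= !big_nil; lra.
set T := \sum_(y <- s) y in IHs *; set Q := \sum_(y <- s) _ in IHs *.
have k_pos : 0 < (size s)%:R :> R by rewrite ltr0n.
move: k_pos IHs; set k := (size s)%:R => k_pos IHs.
(* After multiplication by k > 0, the difference is k + 1 times the slack of the induction
   hypothesis plus a square. *)
rewrite -(ler_pM2l k_pos) -subr_ge0.
have -> : k * ((k + 1) * (a ^+ 2 + Q)) - k * (a + T) ^+ 2 =
  (k + 1) * (k * Q - T ^+ 2) + (k * a - T) ^+ 2 by ring.
by rewrite addr_ge0 ?sqr_ge0 // mulr_ge0 ?subr_ge0 // ltW // ltr_wpDl // ltW.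
Qed.

(** Expanding the square only adds cross products, which are nonnegative. *)
Lemma sum_sqr_le s : all (>= 0) s ->
  \sum_(y <- s) y ^+ 2 <= (\sum_(y <- s) y) ^+ 2.
Proof.
elim: s => [|a s IHs] /=; first by rewrite !big_nil expr0n.
move=> /andP[a_ge0 s_ge0]; rewrite !big_cons sqrrD -addrA lerD2l.
rewrite (le_trans (IHs s_ge0)) // lerDr mulrn_wge0 // mulr_ge0 //.
by rewrite big_seq sumr_ge0 // => y /(allP s_ge0).
Qed.

(* Wolkowicz-Styan bounds without denominators: (k + 1) Q - T^2 is (k + 1)^2
   times the variance of the k + 1 numbers x :: s. *)
Lemma min_deviation x s (k := (size s)%:R)
    (T := x + \sum_(y <- s) y) (Q := x ^+ 2 + \sum_(y <- s) y ^+ 2) :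
  all (>= x) s ->
  [/\ (k + 1) * x <= T,
      (k + 1) * Q - T ^+ 2 <= k * (T - (k + 1) * x) ^+ 2 &
      (T - (k + 1) * x) ^+ 2 <= k * ((k + 1) * Q - T ^+ 2)].
Proof.
move=> x_min.
have s_ge0 : all (>= 0) [seq y - x | y <- s].
  by rewrite all_map; apply: sub_all x_min => y /=; rewrite subr_ge0.
have sumB : \sum_(y <- s) (y - x) = \sum_(y <- s) y - k * x.
  by rewrite sumrB big_const_seq count_predT iter_addr_0 mulr_natl.
have sum2B : \sum_(y <- s) (y - x) ^+ 2 =
    \sum_(y <- s) y ^+ 2 - 2 * x * \sum_(y <- s) y + k * x ^+ 2.
  rewrite (eq_bigr (fun y => y ^+ 2 - 2 * x * y + x ^+ 2)) => [|y _]; last by ring.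
  rewrite big_split /= sumrB -mulr_sumr; congr (_ + _).
  by rewrite big_const_seq count_predT iter_addr_0 mulr_natl.
have ge0 : 0 <= \sum_(y <- s) y - k * x.
  rewrite -sumB big_seq sumr_ge0 // => y /(allP x_min).
  by rewrite subr_ge0.
(* Both bounds come from the nonnegative shifts y - x: the slack in each is k + 1 times the slack in
   one of these two inequalities. *)
have := sum_sqr_le s_ge0; have := sqr_sum_le [seq y - x | y <- s].
rewrite !big_map size_map sumB sum2B -/k /T /Q.
have k_ge0 : 0 <= k by rewrite ler0n.
move: (\sum_(y <- s) y) (\sum_(y <- s) y ^+ 2) ge0 => t q ge0 le1 le2.
split; [lra| |].
- rewrite -subr_ge0.
  have -> : k * (x + t - (k + 1) * x) ^+ 2 - ((k + 1) * (x ^+ 2 + q) - (x + t) ^+ 2)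
    = (k + 1) * ((t - k * x) ^+ 2 - (q - 2 * x * t + k * x ^+ 2)) by ring.
  by apply: mulr_ge0; [lra | rewrite subr_ge0].
- rewrite -subr_ge0.
  have -> : k * ((k + 1) * (x ^+ 2 + q) - (x + t) ^+ 2) - (x + t - (k + 1) * x) ^+ 2
    = (k + 1) * (k * (q - 2 * x * t + k * x ^+ 2) - (t - k * x) ^+ 2) by ring.
  by apply: mulr_ge0; [lra | rewrite subr_ge0].
Qed.

Lemma max_deviation x s (k := (size s)%:R)
    (T := x + \sum_(y <- s) y) (Q := x ^+ 2 + \sum_(y <- s) y ^+ 2) :
  all (<= x) s ->
  [/\ T <= (k + 1) * x,
      (k + 1) * Q - T ^+ 2 <= k * ((k + 1) * x - T) ^+ 2 &
      ((k + 1) * x - T) ^+ 2 <= k * ((k + 1) * Q - T ^+ 2)].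
Proof.
move=> x_max; have /= := @min_deviation (- x) [seq - y | y <- s].
rewrite all_map !big_map size_map sumrN -/k.
under eq_bigr do rewrite sqrrN.
rewrite -opprD -/T !sqrrN -/Q mulrN opprK lerN2 [- T + _]addrC; apply.
by apply: sub_all x_max => y /=; rewrite lerN2.
Qed.

End Deviation.

(** This extracts the radicals from the deviation bounds, with [u] the distance to the mean scaled
    by k + 1. *)
Lemma sqrt_between (R : rcfType) (k p u : R) :
  0 < k -> 0 <= u -> p <= k * u ^+ 2 -> u ^+ 2 <= k * p ->
  Num.sqrt (p / k) <= u <= Num.sqrt (k * p).
Proof.
move=> k_gt0 u_ge0 le1 le2; rewrite -{1 2}[u]ger0_norm // -sqrtr_sqr.
by rewrite !ler_wsqrtr // ler_pdivrMr // mulrC.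
Qed.

(** * Traces and top eigenvalue of the normalized adjacency matrix *)

Section NormalizedAdjacency.
Variables (R : rcfType) (n : nat) (e : rel 'I_n).
Hypothesis e_sym : symmetric e.
Hypothesis e_irr : irreflexive e.
Hypothesis deg_gt0 : forall i, (0 < degree e i)%N.

Local Notation d i := ((degree e i)%:R : R).
Local Notation M := (normalized_adjacency_mx R e).

Lemma sum_adj (i : 'I_n) : \sum_j (e i j)%:R = d i.
Proof.
rewrite -natr_sum /degree -sum1_card [in RHS]big_mkcond /=; congr _%:R.
by apply: eq_bigr => j _; rewrite inE; case: (e i j).
Qed.

Lemma normalized_adjacencyE i j : M i j = (e i j)%:R / d i.
Proof.
have deg_unit k : d k \is a GRing.unit by rewrite unitfE pnatr_eq0 -lt0n.
have Dunit : degree_mx R e \in unitmx.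
  by rewrite unitmxE det_diag; apply: rpred_prod => k _; rewrite mxE.
suff -> : M = \matrix_(i, j) ((e i j)%:R / d i) by rewrite mxE.
apply: (canLR (mulKmx Dunit)); rewrite mul_diag_mx.
by apply/matrixP=> k l; rewrite !mxE mulrC divrK.
Qed.

Lemma row_sum_normalized_adjacency i : \sum_j M i j = 1.
Proof.
under eq_bigr do rewrite normalized_adjacencyE.
by rewrite -mulr_suml sum_adj divff // pnatr_eq0 -lt0n.
Qed.

Lemma trace_normalized_adjacency : \tr M = 0.
Proof. by apply: big1 => i _; rewrite normalized_adjacencyE e_irr mul0r. Qed.

(** The product of the entries (i, j) and (j, i) is the edge weight 1 / (d_i d_j), so the trace runs
    over ordered pairs and meets each edge twice. *)
Lemma trace_sqr_normalized_adjacency : \tr (M *m M) = 2 * randic_index_m1 R e.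
Proof.
pose w i j : R := if e i j then (d i * d j)^-1 else 0.
have wC i j : w i j = w j i by rewrite /w e_sym mulrC.
have -> : \tr (M *m M) = \sum_i \sum_j w i j.
  apply: eq_bigr => i _; rewrite mxE; apply: eq_bigr => j _.
  rewrite !normalized_adjacencyE (e_sym j i) /w.
  by case: (e i j); rewrite ?mul0r // !mul1r invfM.
have -> : randic_index_m1 R e = \sum_(i < n) \sum_(j < n | (i < j)%N) w i j.
  by apply: eq_bigr => i _; rewrite big_mkcondr.
rewrite mulr_natl mulr2n.
(* One copy of the index is summed over the pairs with j < i instead; the diagonal, left over,
   vanishes by irreflexivity. *)
rewrite [X in _ = _ + X](exchange_big_dep predT) //= -big_split /=.
apply: eq_bigr => i _.
rewrite (bigID (fun j : 'I_n => (i < j)%N)) /=; congr (_ + _).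
rewrite (bigID (fun j : 'I_n => (j < i)%N)) /= [X in _ + X]big1 ?addr0.
  by apply: eq_big => [j|j _]; [case: ltngtP|exact: wC].
move=> j; rewrite -!leqNgt => /andP[ji ij].
have -> : j = i by apply/val_inj/eqP; rewrite eqn_leq ji.
by rewrite /w e_irr.
Qed.

(* Detailed balance: the vector of degrees is stationary. *)
Lemma eigenvalue1_normalized_adjacency : (0 < n)%N -> eigenvalue M 1.
Proof.
move=> n_gt0; apply/eigenvalueP; exists (\row_i d i).
  apply/rowP=> j; rewrite !mxE mul1r -sum_adj; apply: eq_bigr => i _.
  rewrite mxE normalized_adjacencyE mulrCA divff ?mulr1 1?e_sym //.
  by rewrite pnatr_eq0 -lt0n.
apply/eqP=> /rowP/(_ (Ordinal n_gt0))/eqP.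
by rewrite !mxE pnatr_eq0 -leqn0 leqNgt deg_gt0.
Qed.

(* A row-stochastic matrix does not increase the l1 norm of row vectors. *)
Lemma eigenvalue_normalized_adjacency_le1 a : eigenvalue M a -> a <= 1.
Proof.
case/eigenvalueP=> v vM v_neq0.
have norm_gt0 : 0 < \sum_j `|v 0 j|.
  rewrite lt_neqAle sumr_ge0 // andbT eq_sym; apply: contraNneq v_neq0.
  move=> /psumr_eq0P v0; apply/eqP/rowP=> j; rewrite mxE.
  by apply/eqP; rewrite -normr_eq0 v0.
apply: le_trans (ler_norm a) _.
rewrite -(ler_pM2r norm_gt0) mul1r mulr_sumr.
have -> : \sum_j `|v 0 j| = \sum_j \sum_i `|v 0 i| * M i j.
  rewrite exchange_big; apply: eq_bigr => i _.
  by rewrite -mulr_sumr row_sum_normalized_adjacency mulr1.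
apply: ler_sum => j _.
have -> : `|a| * `|v 0 j| = `|(v *m M) 0 j| by rewrite vM mxE normrM.
rewrite mxE (le_trans (ler_norm_sum _ _ _)) // ler_sum // => i _.
by rewrite normrM [`|M i j|]ger0_norm // normalized_adjacencyE divr_ge0.
Qed.

End NormalizedAdjacency.

(** Some other vertex exists, and a path to it leaves [i] along an edge. *)
Lemma connected_degree_gt0 (n : nat) (e : rel 'I_n) (i : 'I_n) :
  (1 < n)%N -> connected_graph e -> (0 < degree e i)%N.
Proof.
move=> n_gt1 e_conn.
have /card_gt0P[j] : (0 < #|predC1 i|)%N.
  by rewrite cardC1 card_ord -subn1 subn_gt0.
rewrite inE => ji; have /connectP[[|k p] /=] := e_conn i j.
  by move=> _ /eqP; rewrite (negPf ji).
by case/andP=> eik _ _; apply/card_gt0P; exists k; rewrite inE.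
Qed.

Theorem theorem4p1 (R : rcfType) (n : nat) (e : rel 'I_n)
    (n_ge3 : (3 <= n)%N)
    (e_sym : symmetric e) (e_irr : irreflexive e)
    (e_conn : connected_graph e)
    (lambda : n.-tuple R)
    (lambda_eig : ordered_eigenvalues (normalized_adjacency_mx R e) lambda) :
  let N : R := n%:R in
  let R_1 : R := randic_index_m1 R e in
  let lambda_2 : R := lambda`_1 in
  let lambda_n : R := lambda`_n.-1 in
  (- (1 / (N - 1))
     - 1 / (N - 1) * Num.sqrt ((N - 2) * (2 * (N - 1) * R_1 - N)) <= lambda_n
   /\
   lambda_n <= - (1 / (N - 1))
     - 1 / (N - 1) * Num.sqrt ((2 * (N - 1) * R_1 - N) / (N - 2)))
  /\
  (- (1 / (N - 1))
     + 1 / (N - 1) * Num.sqrt ((2 * (N - 1) * R_1 - N) / (N - 2)) <= lambda_2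
   /\
   lambda_2 <= - (1 / (N - 1))
     + 1 / (N - 1) * Num.sqrt ((N - 2) * (2 * (N - 1) * R_1 - N))).
Proof.
have deg_gt0 i : (0 < degree e i)%N.
  by apply: connected_degree_gt0; first exact: ltnW.
case: lambda_eig => lambda_sorted charM N R_1 lambda_2 lambda_n.
have N_ge3 : 3 <= N by rewrite (ler_nat _ 3).
have sum1 := sum_eigenvalues charM.
have sum2 := sum_sqr_eigenvalues charM.
rewrite trace_normalized_adjacency // in sum1.
rewrite trace_sqr_normalized_adjacency // -/R_1 in sum2.
have eigP a : (a \in tval lambda) = eigenvalue (normalized_adjacency_mx R e) a.
  by rewrite eigenvalue_root_char charM root_prod_XsubC.
have mem1 : 1 \in tval lambda.
  by rewrite eigP eigenvalue1_normalized_adjacency // (leq_trans _ n_ge3).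
have le1 a : a \in tval lambda -> a <= 1.
  by rewrite eigP => /eigenvalue_normalized_adjacency_le1; apply.
have size_lambda := size_tuple lambda.
move: lambda_sorted sum1 sum2 mem1 le1 size_lambda.
rewrite /lambda_2 /lambda_n {lambda_2 lambda_n eigP charM}.
(* [x0] and [x1] become the two largest eigenvalues. *)
case: (tval lambda) => [|x0 [|x1 t]] //.
  by move=> _ _ _ _ _ size_n; exfalso; move: n_ge3; rewrite -size_n.
have ge_trans : transitive (>=%R : rel R).
  by move=> b a c ba cb; exact: le_trans cb ba.
move=> x_sorted; have {}x_sorted : path >=%R x0 (x1 :: t) := x_sorted.
have /allP x0_max := order_path_min ge_trans x_sorted.
move=> sum1 sum2 mem1 le1 size_t.
(* The value 1 occurs in the list, whose maximum is [x0], and no entry exceeds 1. *)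
have x0E : x0 = 1.
  apply/eqP; rewrite eq_le le1 ?mem_head //=.
  by move: mem1; rewrite inE => /predU1P[->|/x0_max].
rewrite {}x0E !big_cons in sum1 sum2.
have t_sorted := path_sorted x_sorted.
have sizeE : (size t)%:R = N - 2 :> R.
  by rewrite /N -size_t /= -!natr1; ring.
have k_gt0 : 0 < N - 2 by lra.
have m_gt0 : 0 < N - 1 by lra.
(* [p] is (n - 1)^2 times the variance of the n - 1 eigenvalues other than [x0]. *)
set p := 2 * (N - 1) * R_1 - N.
have kE : N - 2 + 1 = N - 1 by ring.
have shift u : - (1 / (N - 1)) + 1 / (N - 1) * u = (u - 1) / (N - 1).
  by rewrite !div1r mulrBl mul1r mulrC addrC.
have shiftN u : - (1 / (N - 1)) - 1 / (N - 1) * u = (- u - 1) / (N - 1).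
  by rewrite -[- (_ * u)]mulrN shift.
rewrite !shift !shiftN !ler_pdivlMr // !ler_pdivrMr //.
split.
- have -> : (x0 :: x1 :: t)`_n.-1 = last x1 t.
    by rewrite -size_t [RHS](last_nth 0).
  (* The same n - 1 values are regrouped around their minimum [z], the last entry of the sorted
     list. *)
  have tE := lastI x1 t; set z := last x1 t in tE *; set s := belast x1 t in tE.
  have sizes : (size s)%:R = N - 2 :> R by rewrite -sizeE size_belast.
  have z_min : all (>= z) s.
    have := t_sorted; rewrite tE sorted_pairwise //.
    by rewrite -cats1 pairwise_cat allrel1r => /and3P[].
  have sumE (f : R -> R) : f x1 + \sum_(y <- t) f y = f z + \sum_(y <- s) f y.
    have <- : \sum_(y <- x1 :: t) f y = f x1 + \sum_(y <- t) f y.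
      by rewrite big_cons.
    by rewrite tE -cats1 big_cat big_seq1 addrC.
  have := min_deviation z_min.
  rewrite sizes kE -(sumE id) -(sumE (fun y => y ^+ 2)).
  have -> : x1 + \sum_(y <- t) y = - 1 by move: sum1; lra.
  have -> : x1 ^+ 2 + \sum_(y <- t) y ^+ 2 = 2 * R_1 - 1 by move: sum2; lra.
  have -> : (N - 1) * (2 * R_1 - 1) - (- 1) ^+ 2 = p by rewrite /p; ring.
  case=> ge0; rewrite -subr_ge0 in ge0.
  (* Here u = -1 - (N - 1) z, the scaled distance of [z] below the mean -1 / (N - 1). *)
  by move=> /(sqrt_between k_gt0 ge0) /[apply] /andP[]; lra.
(* [x1] is the maximum of the remaining eigenvalues, and u = (N - 1) x1 + 1. *)
- have /max_deviation := order_path_min ge_trans t_sorted.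
  rewrite sizeE kE -[_`_1]/x1.
  have -> : x1 + \sum_(y <- t) y = - 1 by move: sum1; lra.
  have -> : x1 ^+ 2 + \sum_(y <- t) y ^+ 2 = 2 * R_1 - 1 by move: sum2; lra.
  have -> : (N - 1) * (2 * R_1 - 1) - (- 1) ^+ 2 = p by rewrite /p; ring.
  case=> ge0; rewrite -subr_ge0 in ge0.
  by move=> /(sqrt_between k_gt0 ge0) /[apply] /andP[]; lra.
Qed.
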